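(* There is a unital homomorphism $\phi: C(\mathbb T)\to C(S^3, M_2)$ such that $\phi$ cannot be approximately diagonalized.
   Context: $\mathbb T$ is the unit circle, $S^3$ the 3-sphere, $M_n$ the $n\times n$ complex matrices; homomorphisms are $*$-homomorphisms. For compact metric spaces $X,Y$, a unital homomorphism $\phi:C(X)\to C(Y,M_n)$ can be approximately diagonalized if for every $\epsilon>0$ and every finite subset $\mathcal F\subset C(X)$ there are continuous maps $\alpha_i:Y\to X$ ($1\le i\le n$) and mutually orthogonal rank one projections $p_1,\dots,p_n\in C(Y,M_n)$ (i.e. $p_i(y)$ has rank one for every $y\in Y$) such that $\|\phi(f)-\sum_{i=1}^n (f\circ\alpha_i)p_i\|<\epsilon$ for all $f\in\mathcal F$. *)

(* Defs.v *)
From HB Require Import structures.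
From mathcomp Require Import all_boot all_order all_algebra spectral.
From mathcomp Require Import complex.
From mathcomp Require Import all_classical all_reals all_analysis.

Set Implicit Arguments.
Unset Strict Implicit.
Unset Printing Implicit Defensive.

Import Order.TTheory GRing.Theory Num.Theory.
Import numFieldNormedType.Exports.

Local Open Scope classical_set_scope.
Local Open Scope ring_scope.
Local Open Scope sesquilinear_scope.

(* Packaging R[i] as a numClosedFieldType is what gives it, and matrices over
   it, the topology of the modulus. *)
Definition Cplx (R : realType) : numClosedFieldType := R[i].

Definition circle (R : realType) : set (Cplx R) := [set z | `|z| = 1].

Definition sphere3 (R : realType) : set 'rV[R]_4 :=
  [set x | \sum_(i < 4) x 0 i ^+ 2 = 1].

Arguments circle R _ : clear implicits.
Arguments sphere3 R _ : clear implicits.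

Section ContinuousFunctions.
Context {R : realType} {X : topologicalType}.
Local Notation CX := (continuousType X (Cplx R)).

Lemma cfun_add_continuous (f g : CX) : continuous (fun x => f x + g x).
Proof. by move=> x; apply: cvgD; exact: cts_fun. Qed.

Lemma cfun_mul_continuous (f g : CX) : continuous (fun x => f x * g x).
Proof. by move=> x; apply: cvgM; exact: cts_fun. Qed.

Lemma cfun_scale_continuous (c : Cplx R) (f : CX) :
  continuous (fun x => c * f x).
Proof. by move=> x; apply: cvgM; [exact: cvg_cst|exact: cts_fun]. Qed.

Lemma cfun_conj_continuous (f : CX) : continuous (fun x => (f x)^*).
Proof.
move=> x; apply/cvgrPdist_lt => e e0.
have /cvgrPdist_lt/(_ e e0) := @cts_fun _ _ f x.
by apply: filterS => y; rewrite -rmorphB norm_conjC.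
Qed.

Definition cfun_one : CX := cst 1.
Definition cfun_add (f g : CX) : CX := mkcts (@cfun_add_continuous f g).
Definition cfun_mul (f g : CX) : CX := mkcts (@cfun_mul_continuous f g).
Definition cfun_scale (c : Cplx R) (f : CX) : CX :=
  mkcts (@cfun_scale_continuous c f).
Definition cfun_conj (f : CX) : CX := mkcts (@cfun_conj_continuous f).

End ContinuousFunctions.

(* The operations of C(Y, M_n) are pointwise, hence the evaluations at y. *)
Record unital_star_hom {R : realType} {X Y : topologicalType} {n : nat}
    (phi : continuousType X (Cplx R) -> continuousType Y 'M[Cplx R]_n) :
    Prop := UnitalStarHom {
  hom_one : forall y, phi cfun_one y = 1%:M;
  hom_add : forall f g y, phi (cfun_add f g) y = phi f y + phi g y;
  hom_scale : forall c f y, phi (cfun_scale c f) y = c *: phi f y;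
  hom_mul : forall f g y, phi (cfun_mul f g) y = phi f y *m phi g y;
  hom_star : forall f y, phi (cfun_conj f) y = (phi f y) ^t*
}.

Section Norms.
Context {R : realType}.

Definition l2norm {n : nat} (v : 'cV[Cplx R]_n) : R :=
  Num.sqrt (\sum_(i < n) Normc.normc (v i 0) ^+ 2).

Definition opnorm {n : nat} (A : 'M[Cplx R]_n) : \bar R :=
  ereal_sup [set (l2norm (A *m v))%:E | v in [set v | l2norm v <= 1]].

(* The C*-norm of C(Y, M_n) when Y is compact. *)
Definition supnorm {Y : Type} {n : nat} (g : Y -> 'M[Cplx R]_n) : \bar R :=
  ereal_sup (range (fun y => opnorm (g y))).

End Norms.

Definition rank_one_projection {R : realType} {Y : Type} {n : nat}
    (p : Y -> 'M[Cplx R]_n) : Prop :=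
  forall y, [/\ p y *m p y = p y, (p y) ^t* = p y & \rank (p y) = 1%N].

Definition approximately_diagonalizable {R : realType} {X Y : topologicalType}
    {n : nat}
    (phi : continuousType X (Cplx R) -> continuousType Y 'M[Cplx R]_n) : Prop :=
  forall (eps : R) (F : set (continuousType X (Cplx R))),
    0 < eps -> finite_set F ->
    exists (alpha : 'I_n -> continuousType Y X)
           (p : 'I_n -> continuousType Y 'M[Cplx R]_n),
      [/\ forall i, rank_one_projection (p i),
          forall i j, i != j -> forall y, p i y *m p j y = 0 &
          forall f, F f ->
            (supnorm (fun y => phi f y - \sum_(i < n) f (alpha i y) *: p i y)%R
               < eps%:E)%E].

(* Main.v *)
Require Import Defs.
From mathcomp Require Import all_boot all_order all_algebra spectral.
From mathcomp Require Import complex ring lra.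
From mathcomp Require Import all_classical all_reals all_analysis.
Import numFieldNormedType.Exports.

(* Write y in S^3 as (y0, x) with x in R^3, and let phi be the functional
   calculus of the unitary y0 + i x.sigma, whose eigenvalues are y0 +- i |x|; a
   direction x / |x| is only needed where the two eigenvalues differ.
   If phi were approximately diagonalizable, the range of the first projection
   p over the contractible hemisphere y0 >= 0 would have a nonvanishing section
   v, obtained by transport from the pole.  On the equatorial 2-sphere
   i x.sigma v is close to alpha v with |alpha| = 1, so <v, x.sigma v> does not
   vanish and has constant sign; a positive sign means that the projection of v
   to the tautological (Hopf) line of x never vanishes.  In polar coordinates
   this is a homotopy of nonvanishing loops from a constant to e^(- i theta),
   which is excluded by the parity of the winding number: along the homotopy
   the loop remains the square of a closed loop, up to positive and constant
   factors. *)

Set Implicit Arguments.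
Unset Strict Implicit.
Unset Printing Implicit Defensive.

Import Order.TTheory GRing.Theory Num.Theory.

Local Open Scope classical_set_scope.
Local Open Scope ring_scope.
Local Open Scope sesquilinear_scope.

(** * Continuity rules *)

Section ContinuityRules.
Context {S T U : topologicalType} {K : numFieldType}.

Lemma ctsC (f : S -> T) (g : T -> U) :
  continuous f -> continuous g -> continuous (fun x => g (f x)).
Proof. by move=> cf cg x; exact: (continuous_comp (cf x) (cg (f x))). Qed.

Lemma cts_pair (f : S -> T) (g : S -> U) :
  continuous f -> continuous g -> continuous (fun x => (f x, g x)).
Proof. by move=> cf cg x; apply: cvg_pair; [exact: cf|exact: cg]. Qed.

Lemma cts_fst (f : S -> T * U) : continuous f -> continuous (fun x => (f x).1).
Proof. by move=> cf x; exact: (cvg_comp _ _ (cf x) cvg_fst). Qed.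

Lemma cts_snd (f : S -> T * U) : continuous f -> continuous (fun x => (f x).2).
Proof. by move=> cf x; exact: (cvg_comp _ _ (cf x) cvg_snd). Qed.

Lemma cts_id : continuous (fun x : S => x).
Proof. by move=> x; exact: cvg_id. Qed.

Lemma cts_cst (c : T) : continuous (fun _ : S => c).
Proof. by move=> x; exact: cvg_cst. Qed.

Lemma ctsD (f g : S -> K) :
  continuous f -> continuous g -> continuous (fun x => f x + g x).
Proof. by move=> cf cg x; exact: (cvgD (cf x) (cg x)). Qed.

Lemma ctsN (f : S -> K) : continuous f -> continuous (fun x => - f x).
Proof. by move=> cf x; exact: (cvgN (cf x)). Qed.

Lemma ctsM (f g : S -> K) :
  continuous f -> continuous g -> continuous (fun x => f x * g x).
Proof. by move=> cf cg x; exact: (cvgM (cf x) (cg x)). Qed.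

Lemma ctsX (n : nat) (f : S -> K) :
  continuous f -> continuous (fun x => f x ^+ n).
Proof.
move=> cf; elim: n => [|n IH]; first by move=> x; exact: cvg_cst.
rewrite (_ : (fun x => _) = (fun x => f x * f x ^+ n)); first exact: ctsM.
by apply/funext => x; rewrite exprS.
Qed.

End ContinuityRules.

Ltac cts := repeat match goal with
  | H : ?P |- ?P => exact H
  | |- continuous ?f => lazymatch f with
    | fun x => x => exact: cts_id
    | fun _ => ?c => exact: cts_cst
    | fun x => (_, _) => apply: cts_pair
    | fun x => fst _ => apply: cts_fst
    | fun x => snd _ => apply: cts_snd
    | fst => exact: (cts_fst (@cts_id _))
    | snd => exact: (cts_snd (@cts_id _))
    | fun x => _ + _ => apply: ctsD
    | fun x => - _ => apply: ctsN
    | fun x => _ * _ => apply: ctsM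
    | fun x => _ ^+ _ => apply: ctsX
    end
  end.

Section MatrixContinuity.
Context {S : topologicalType} {K : numFieldType}.

Lemma cts_sum (I : Type) (r : seq I) (F : I -> S -> K) :
  (forall i, continuous (F i)) -> continuous (fun x => \sum_(i <- r) F i x).
Proof.
move=> cF; elim: r => [|i r IH].
  by under [X in continuous X]eq_fun do rewrite big_nil; exact: cts_cst.
by under [X in continuous X]eq_fun do rewrite big_cons; apply: ctsD.
Qed.

Lemma cts_prod (I : Type) (r : seq I) (F : I -> S -> K) :
  (forall i, continuous (F i)) -> continuous (fun x => \prod_(i <- r) F i x).
Proof.
move=> cF; elim: r => [|i r IH].
  by under [X in continuous X]eq_fun do rewrite big_nil; exact: cts_cst.
by under [X in continuous X]eq_fun do rewrite big_cons; apply: ctsM.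
Qed.

Lemma cts_det n (M : S -> 'M[K]_n) :
  (forall i j, continuous (fun x => M x i j)) ->
  continuous (fun x => \det (M x)).
Proof.
move=> cM; rewrite /determinant; apply: cts_sum => s.
by apply: ctsM; [exact: cts_cst|apply: cts_prod => i].
Qed.

Lemma cts_mulmx m n p (M : S -> 'M[K]_(m, n)) (N : S -> 'M[K]_(n, p)) :
  (forall i j, continuous (fun x => M x i j)) ->
  (forall i j, continuous (fun x => N x i j)) ->
  forall i j, continuous (fun x => (M x *m N x) i j).
Proof.
move=> cM cN i j.
under [X in continuous X]eq_fun do rewrite mxE.
by apply: cts_sum => k; apply: ctsM.
Qed.

Lemma cts_mx m n (M : S -> 'M[K]_(m, n)) :
  (forall i j, continuous (fun x => M x i j)) -> continuous M.
Proof.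
move=> cM x; apply/cvg_ballP => e e0.
have H : \forall y \near x, forall ij : 'I_m * 'I_n,
    ball (M x ij.1 ij.2) e (M y ij.1 ij.2).
  by apply: filter_forall => -[i j] /=; exact: (cvg_ball (cM i j x)).
by apply: filterS H => y H; split => // i j; exact: (H (i, j)).
Qed.

End MatrixContinuity.

Section ComplexContinuity.
Context {R : realType} {S : topologicalType}.
Local Open Scope complex_scope.

Let RC (e : R) : 0 < e -> 0 < e%:C :> Cplx R.
Proof. by rewrite ltcR. Qed.

Let normRe (z : Cplx R) : (`|complex.Re z|)%:C <= `|z|.
Proof.
case: z => a b; rewrite normc_def lecR -sqrtr_sqr /= ler_sqrt ?lerDl ?sqr_ge0//.
by rewrite addr_ge0 ?sqr_ge0.
Qed.

Let normIm (z : Cplx R) : (`|complex.Im z|)%:C <= `|z|.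
Proof.
case: z => a b; rewrite normc_def lecR -sqrtr_sqr /= ler_sqrt ?lerDr ?sqr_ge0//.
by rewrite addr_ge0 ?sqr_ge0.
Qed.

Lemma cts_Re (f : S -> Cplx R) :
  continuous f -> continuous (fun x => complex.Re (f x) : R).
Proof.
move=> cf x; apply/cvgrPdist_lt => e e0.
have /cvgrPdist_lt/(_ _ (RC e0)) := cf x.
apply: filterS => y; rewrite -ltcR; apply: le_lt_trans.
by have := normRe (f x - f y); case: (f x) (f y) => ? ? [].
Qed.

Lemma cts_Im (f : S -> Cplx R) :
  continuous f -> continuous (fun x => complex.Im (f x) : R).
Proof.
move=> cf x; apply/cvgrPdist_lt => e e0.
have /cvgrPdist_lt/(_ _ (RC e0)) := cf x.
apply: filterS => y; rewrite -ltcR; apply: le_lt_trans.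
by have := normIm (f x - f y); case: (f x) (f y) => ? ? [].
Qed.

Lemma cts_real_complex (f : S -> R) : continuous f ->
  continuous (fun x => (f x)%:C : Cplx R).
Proof.
move=> cf x; apply/cvgrPdist_lt => e e0.
have eE : e = (complex.Re e)%:C by rewrite RRe_real// gtr0_real.
have Re0 : 0 < complex.Re e by move: e0; rewrite eE ltcR.
have /cvgrPdist_lt/(_ _ Re0) := cf x.
apply: filterS => y; rewrite -rmorphB /= normc_def /= expr0n addr0 sqrtr_sqr.
by rewrite eE ltcR.
Qed.

Lemma cts_complex (f g : S -> R) : continuous f -> continuous g ->
  continuous (fun x => (f x +i* g x : Cplx R)).
Proof.
move=> cf cg.
rewrite (_ : (fun x => _) = fun x => (f x)%:C + 'i%C * (g x)%:C : Cplx R);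
  last first.
  by apply/funext => x; rewrite [LHS]complexE.
by cts; exact: cts_real_complex.
Qed.

End ComplexContinuity.

Lemma cts_set_type (S T : topologicalType) (A : set T) (f : S -> T)
    (fA : forall x, f x \in A) :
  continuous f -> continuous (fun x => exist _ (f x) (fA x) : set_type A).
Proof. by move=> cf; apply: continuous_comp_initial. Qed.

Lemma cts_set_val (T : topologicalType) (A : set T) :
  continuous (set_val : set_type A -> T).
Proof. exact: initial_continuous. Qed.

(* The factor [m] may be discontinuous where [w] vanishes. *)
Lemma cts_mul_bounded (S : topologicalType) (K : numFieldType) (w m : S -> K) :
  continuous w -> (forall x, `|m x| <= 1) ->
  (forall x, w x != 0 -> {for x, continuous m}) ->
  continuous (fun x => w x * m x).
Proof.
move=> cw m1 cm x; have [w0|/cm cmx] := eqVneq (w x) 0; last first.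
  exact: (cvgM (cw x) cmx).
apply/cvgrPdist_lt => e e0.
have /cvgrPdist_lt/(_ _ e0) := cw x.
apply: filterS => y /=; rewrite w0 mul0r !sub0r !normrN normrM; apply: le_lt_trans.
by rewrite ler_piMr.
Qed.

(** * Winding parity *)

(** Connectedness of the interval, with a step that may start on either side of t: at the supremum
    of the points satisfying [P], it leads from a point at or just below to one just above, or to b
    itself. *)
Lemma segment_near_diagonal (R : realType) (P : R -> Prop) (a b : R) :
  a <= b -> P a ->
  (forall t, a <= t <= b -> \forall z \near (t, t), P z.1 -> P z.2) ->
  P b.
Proof.
move=> ab Pa HP.
have loc t : a <= t <= b -> exists2 e : R, 0 < e &
    forall x y, `|t - x| < e -> `|t - y| < e -> P x -> P y.
  move=> /HP [[A B] /= [nA nB] sAB].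
  have [e /= e0 eAB] := (nbhs_ballP _ _).1 (filterI nA nB).
  exists e => // x y tx ty; apply: (sAB (x, y)); split => /=.
  - by have [] := eAB x tx.
  - by have [] := eAB y ty.
pose S := [set x | a <= x <= b /\ P x].
have Sa : S a by split; rewrite ?lexx.
have supS : has_sup S by split; [exists a | exists b => x [] /andP[]].
have as_ : a <= sup S by apply: ub_le_sup => //; case: supS.
have sb : sup S <= b by apply: ge_sup; [exists a | move=> x [] /andP[]].
have [|e e0 He] := loc (sup S); first by rewrite as_ sb.
have [x Sx xs] := sup_adherent e0 supS.
have xle : x <= sup S by apply: ub_le_sup => //; case: supS.
have xe : `|sup S - x| < e by rewrite ger0_norm ?subr_ge0//; lra.
have [sltb|] := ltP (sup S) b; last first.
  move=> bs; apply: (He x) => //; last by case: Sx.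
  have -> : b = sup S by apply: le_anti; rewrite bs sb.
  by rewrite subrr normr0.
pose y := Num.min b (sup S + e / 2).
have ys : sup S < y by rewrite /y lt_min sltb /= ltrDl; lra.
have ye : y <= sup S + e / 2 by rewrite /y ge_min lexx orbT.
suff : S y by move=> /(ub_le_sup (proj2 supS)); rewrite leNgt ys.
split; first by rewrite (le_trans as_ (ltW ys)) /y ge_min lexx.
apply: (He x) => //; last by case: Sx.
by rewrite distrC gtr0_norm ?subr_gt0//; lra.
Qed.

(** The last loop is (c + i d) e^(- 2 i s), which winds once on [0, pi]. Being a square up to
    factors propagates in t without lifting angles: the quotient of two nearby loops lies in the
    right half-plane, where a continuous square root exists. A loop of odd winding number has no
    closed square root. *)
Lemma no_winding_homotopy (R : realType) (A : R) (g h : R * R -> R) :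
  0 <= A -> continuous g -> continuous h ->
  (forall t s : R, 0 <= t <= A -> 0 <= s <= pi ->
     0 < g (t, s) ^+ 2 + h (t, s) ^+ 2) ->
  (forall t, g (t, 0) = g (t, pi) /\ h (t, 0) = h (t, pi)) ->
  (forall s, g (0, s) = g (0, 0) /\ h (0, s) = h (0, 0)) ->
  (exists c d : R, forall s,
     [/\ g (A, s) = c * (cos s ^+ 2 - sin s ^+ 2) + d * (2 * sin s * cos s) &
         h (A, s) = d * (cos s ^+ 2 - sin s ^+ 2) - c * (2 * sin s * cos s)]) ->
  False.
Proof.
move=> A0 cg ch gh0 per gh00 [c [d ghA]].
pose g0 := g (0, 0); pose h0 := h (0, 0).
(* [P t]: g + i h = r (g0 + i h0) (a + i b) ^ 2 at time [t], with r > 0. *)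
pose P t := exists a b : R -> R, [/\ continuous a, continuous b,
  a 0 = a pi, b 0 = b pi & forall s, 0 <= s <= pi ->
  exists2 r, 0 < r & [/\ 0 < a s ^+ 2 + b s ^+ 2,
     g (t, s) = r * (g0 * (a s ^+ 2 - b s ^+ 2) - h0 * (2 * a s * b s)) &
     h (t, s) = r * (h0 * (a s ^+ 2 - b s ^+ 2) + g0 * (2 * a s * b s))]].
have slice (f : R * R -> R) (t : R) :
    continuous f -> continuous (fun s : R => f (t, s) : R).
  by move=> cf; apply: (@ctsC _ _ _ (fun s : R => (t, s)) f) => //; cts.
have P0 : P 0.
  exists (cst 1), (cst 0); split=> // [||s _]; try by move=> x; apply: cvg_cst.
  exists 1 => //; case: (gh00 s) => -> -> /=; split; rewrite -/g0 -/h0; try ring.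
  by rewrite expr1n expr0n /= addr0.
have : P A.
  apply: (segment_near_diagonal A0 P0) => t tA.
  (* [X z s] is the scalar product of the loops at times z.1 and z.2; compactness of [0, pi] makes
     it positive for all s at once when z is near (t, t). *)
  pose X (z : R * R) s := g (z.1, s) * g (z.2, s) + h (z.1, s) * h (z.2, s).
  have nearX : \forall z \near (t, t), forall s, s \in `[0, pi] -> 0 < X z s.
    have := @segment_compact R 0 pi; rewrite compact_near_coveringP.
    move=> /(_ _ (nbhs ((t, t) : R * R)) (fun z s => 0 < X z s)).
    have cX : continuous (fun w : R * (R * R) => X w.2 w.1).
      have pr (f k : R * R -> R) : continuous f -> continuous k ->
          continuous (fun w : R * (R * R) => f (k w.2, w.1) : R).
        move=> cf ck.
        apply: (@ctsC _ _ _ (fun w : R * (R * R) => (k w.2, w.1)) f) => //.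
        apply: cts_pair; last by cts.
        by apply: (@ctsC _ _ _ (fun w : R * (R * R) => w.2) k) => //; cts.
      by rewrite /X; do ?[apply: ctsD|apply: ctsM]; apply: pr => //; cts.
    apply => s; rewrite /= in_itv /= => s0.
    have X0 : 0 < X (t, t) s by rewrite /X /= -!expr2; apply: gh0.
    exact: (cvgr_gt _ (cX (s, (t, t))) _ X0).
  near=> z.
  have Xz : forall s, s \in `[0, pi] -> 0 < X z s by near: z.
  move=> [a [b [ca cb a0 b0 ab]]].
  (* x + i y is the conjugate of the loop at [z.1] times the loop at [z.2];
     its square root is m + i y up to a positive factor. *)
  pose x s := X z s.
  pose y s := h (z.2, s) * g (z.1, s) - g (z.2, s) * h (z.1, s).
  pose m s := x s + Num.sqrt (x s ^+ 2 + y s ^+ 2).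
  have cx : continuous x by rewrite /x /X; cts; apply: slice.
  have cy : continuous y by rewrite /y; cts; apply: slice.
  have cm : continuous m.
    rewrite /m; cts; apply: (ctsC (g := Num.sqrt)); first by cts.
    exact: sqrt_continuous.
  have x0 : x 0 = x pi.
    by rewrite /x /X; case: (per z.1) => -> ->; case: (per z.2) => -> ->.
  have y0 : y 0 = y pi.
    by rewrite /y; case: (per z.1) => -> ->; case: (per z.2) => -> ->.
  exists (fun s => a s * m s - b s * y s), (fun s => a s * y s + b s * m s).
  split.
  - by cts.
  - by cts.
  - by rewrite /m a0 b0 x0 y0.
  - by rewrite /m a0 b0 x0 y0.
  move=> s s0; have [r r0 [S0 E1 E2]] := ab s s0.
  have xs : 0 < x s by apply: Xz; rewrite in_itv.
  have ms : 0 < m s by rewrite /m ltr_wpDr// sqrtr_ge0.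
  have mE : m s ^+ 2 - y s ^+ 2 = 2 * m s * x s.
    have : (m s - x s) ^+ 2 = x s ^+ 2 + y s ^+ 2.
      rewrite /m addrC addKr sqr_sqrtr// addr_ge0 ?sqr_ge0//.
    by move=> H; lra.
  pose n := g (z.1, s) ^+ 2 + h (z.1, s) ^+ 2.
  have n0 : 0 < n.
    rewrite /n; suff: 0 != n by rewrite lt_neqAle => -> /=;
      rewrite addr_ge0 ?sqr_ge0.
    apply/eqP => /esym/eqP; rewrite /n paddr_eq0 ?sqr_ge0// !sqrf_eq0.
    move=> /andP[/eqP e1 /eqP e2].
    by move: xs; rewrite /x /X e1 e2 !mul0r addr0 ltxx.
  (* Writing f1 and f2 for the loops at z.1 and z.2, f2 = f1 (x + i y) / n with n = |f1|^2, and [mE]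
     says that x + i y = (m + i y)^2 / (2 m). *)
  exists (r / (n * (2 * m s))); first by rewrite divr_gt0// !mulr_gt0.
  have nm : n * (2 * m s) != 0 by rewrite !mulf_neq0 ?gt_eqF.
  split.
  - have -> : (a s * m s - b s * y s) ^+ 2 + (a s * y s + b s * m s) ^+ 2 =
      (a s ^+ 2 + b s ^+ 2) * (m s ^+ 2 + y s ^+ 2) by ring.
    by rewrite mulr_gt0// ltr_wpDr ?sqr_ge0// exprn_gt0.
  - apply: (mulIf nm); rewrite mulrAC divfK//.
    have -> : g (z.2, s) * (n * (2 * m s)) =
        2 * m s * x s * g (z.1, s) - 2 * m s * y s * h (z.1, s).
      by rewrite /n /x /X /y; ring.
    by rewrite -mE E1 E2; ring.
  - apply: (mulIf nm); rewrite mulrAC divfK//.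
    have -> : h (z.2, s) * (n * (2 * m s)) =
        2 * m s * x s * h (z.1, s) + 2 * m s * y s * g (z.1, s).
      by rewrite /n /x /X /y; ring.
    by rewrite -mE E1 E2; ring.
move=> [a [b [ca cb a0 b0 ab]]].
(* p + i q = (a + i b) e^(i s) changes sign between 0 and pi, while its square
   has constant argument. *)
pose p s := a s * cos s - b s * sin s.
pose q s := a s * sin s + b s * cos s.
pose L s := p s * p 0 + q s * q 0.
have cL : continuous L.
  by rewrite /L /p /q; cts; first [exact: continuous_cos|exact: continuous_sin].
have i0 : 0 <= (0 : R) <= pi by rewrite lexx pi_ge0.
have ipi : 0 <= (pi : R) <= pi by rewrite lexx pi_ge0.
have pq s : p s ^+ 2 + q s ^+ 2 = a s ^+ 2 + b s ^+ 2.
  have := cos2Dsin2 s => H.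
  transitivity ((a s ^+ 2 + b s ^+ 2) * (cos s ^+ 2 + sin s ^+ 2));
    last by rewrite H mulr1.
  by rewrite /p /q; ring.
have [r0 r0p [ab0 F1 F2]] := ab 0 i0.
have L0 : 0 < L 0 by rewrite /L -!expr2 pq.
have Lpi : L pi < 0.
  suff -> : L pi = - L 0 by rewrite oppr_lt0.
  by rewrite /L /p /q cospi sinpi cos0 sin0 -a0 -b0; ring.
have [s] : exists2 s, s \in `[0, pi] & L s = 0.
  apply: (@IVT R L) => //; first exact: pi_ge0.
    exact: continuous_subspaceT.
  rewrite ge_min (ltW Lpi) orbT /= le_max (ltW L0) //.
rewrite in_itv /= => s0 Ls.
have [r rp [abs E1 E2]] := ab s s0.
(* Multiplication by e^(2 i u) turns the loop at time [A] into the constant c + i d, and (a + i b)^2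
   into (p + i q)^2. *)
have rot u k : 0 <= u <= pi -> g (A, u) =
      k * (g0 * (a u ^+ 2 - b u ^+ 2) - h0 * (2 * a u * b u)) ->
    h (A, u) = k * (h0 * (a u ^+ 2 - b u ^+ 2) + g0 * (2 * a u * b u)) ->
    c = k * (g0 * (p u ^+ 2 - q u ^+ 2) - h0 * (2 * p u * q u)) /\
    d = k * (h0 * (p u ^+ 2 - q u ^+ 2) + g0 * (2 * p u * q u)).
  move=> u0 e1 e2; have [e3 e4] := ghA u; have H := cos2Dsin2 u.
  pose C := cos u ^+ 2 - sin u ^+ 2; pose D := 2 * sin u * cos u.
  have CD : C ^+ 2 + D ^+ 2 = 1.
    by rewrite -[RHS](expr1n _ 2) -H /C /D; ring.
  split.
    transitivity (g (A, u) * C - h (A, u) * D).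
      by rewrite e3 e4 -/C -/D -[LHS]mulr1 -CD; ring.
    by rewrite e1 e2 /p /q /C /D; ring.
  transitivity (g (A, u) * D + h (A, u) * C).
    by rewrite e3 e4 -/C -/D -[LHS]mulr1 -CD; ring.
  by rewrite e1 e2 /p /q /C /D; ring.
have [c1 d1] := rot s r s0 E1 E2.
have [c2 d2] := rot 0 r0 i0 F1 F2.
(* [L s] and [X] are, up to sign, the real and imaginary parts of the product of p + i q at s with
   its conjugate at 0. Where [L s] vanishes, the two values are orthogonal and their squares point
   in opposite directions, although both squares are positive multiples of (c + i d) / (g0 + i
   h0). *)
pose X := p s * q 0 - q s * p 0.
have n0 : 0 < g0 ^+ 2 + h0 ^+ 2 by apply: gh0; rewrite lexx ?pi_ge0.
have pos : 0 < c ^+ 2 + d ^+ 2.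
  have -> : c ^+ 2 + d ^+ 2 =
      r ^+ 2 * (g0 ^+ 2 + h0 ^+ 2) * (p s ^+ 2 + q s ^+ 2) ^+ 2.
    by rewrite c1 d1; ring.
  by rewrite pq !mulr_gt0 ?exprn_gt0.
have neg : c * c + d * d = - (r * r0 * (g0 ^+ 2 + h0 ^+ 2) * X ^+ 2).
  transitivity (r * r0 * (g0 ^+ 2 + h0 ^+ 2) * (L s ^+ 2 - X ^+ 2)).
    by rewrite {1}c1 {1}d1 c2 d2 /L /X; ring.
  by rewrite Ls; ring.
move: pos; rewrite !expr2 neg oppr_gt0 ltNge mulr_ge0 ?sqr_ge0//.
by rewrite !mulr_ge0 ?ltW.
Unshelve. all: by end_near.
Qed.

(** * Sections of the Hopf line bundle *)

Section Hedgehog.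
Context {R : realType}.
Implicit Types (z w : R * R) (a b c d : R * R -> R).

(* Polar coordinates on the 2-sphere, [z] being half of the two angles. *)
Definition sphx z : R :=
  2 * sin z.1 * cos z.1 * (cos z.2 ^+ 2 - sin z.2 ^+ 2).
Definition sphy z : R := 2 * sin z.1 * cos z.1 * (2 * sin z.2 * cos z.2).
Definition sphz z : R := cos z.1 ^+ 2 - sin z.1 ^+ 2.

(** Functions on the 2-sphere are represented by functions of z that respect this relation. *)
Definition same_point z w :=
  [/\ sphx z = sphx w, sphy z = sphy w & sphz z = sphz w].

Lemma sph_norm z : sphx z ^+ 2 + sphy z ^+ 2 + sphz z ^+ 2 = 1.
Proof.
rewrite /sphx /sphy /sphz; set C := cos z.1; set S := sin z.1.
set c := cos z.2; set s := sin z.2.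
have H : C ^+ 2 + S ^+ 2 = 1 by exact: cos2Dsin2.
have h : c ^+ 2 + s ^+ 2 = 1 by exact: cos2Dsin2.
transitivity (4 * S ^+ 2 * C ^+ 2 * (c ^+ 2 + s ^+ 2) ^+ 2 + (C ^+ 2 - S ^+ 2) ^+ 2);
  first by ring.
rewrite h expr1n mulr1; transitivity ((C ^+ 2 + S ^+ 2) ^+ 2); first by ring.
by rewrite H expr1n.
Qed.

Lemma cts_sph : [/\ continuous sphx, continuous sphy & continuous sphz].
Proof.
have cc (f : R * R -> R) : continuous f -> continuous (fun z => cos (f z)).
  by move=> cf; apply: (@ctsC _ _ _ f cos) => //; exact: continuous_cos.
have cs (f : R * R -> R) : continuous f -> continuous (fun z => sin (f z)).
  by move=> cf; apply: (@ctsC _ _ _ f sin) => //; exact: continuous_sin.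
have c1 : continuous (fun z : R * R => z.1) by cts.
have c2 : continuous (fun z : R * R => z.2) by cts.
by split; rewrite /sphx /sphy /sphz; cts; first [exact: cc|exact: cs].
Qed.

(* [<v, H v>] for [v = (a + i b, c + i d)] and [H = x.sigma]. *)
Definition pauli_form a b c d z : R :=
  sphz z * (a z ^+ 2 + b z ^+ 2 - c z ^+ 2 - d z ^+ 2) +
  2 * (sphx z * (a z * c z + b z * d z) + sphy z * (a z * d z - b z * c z)).

(** As the angles are halved, this rectangle covers the whole sphere; its edges z.1 = 0 and z.1 = pi
    / 2 are the two poles. *)
Definition in_rect z := 0 <= z.1 <= pi / 2 /\ 0 <= z.2 <= pi.

(** The rectangle is star-shaped about (0, 0), so a change of sign would produce a zero on the
    segment from there to z. *)
Lemma rect_sign (f : R * R -> R) : continuous f ->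
  (forall z, in_rect z -> f z != 0) -> 0 < f (0, 0) ->
  forall z, in_rect z -> 0 < f z.
Proof.
move=> cf f0 f00 z [z1 z2]; rewrite ltNge; apply/negP => fz.
pose k (u : R) := f (u * z.1, u * z.2).
have ck : continuous k.
  by apply: (@ctsC _ _ _ (fun u : R => (u * z.1, u * z.2)) f) => //; cts.
have k0 : k 0 = f (0, 0) by rewrite /k !mul0r.
have k1 : k 1 = f z by rewrite /k !mul1r -surjective_pairing.
have [u] : exists2 u, u \in `[0, 1] & k u = 0.
  apply: (@IVT R k) => //; first exact: continuous_subspaceT.
  by rewrite k0 k1 ge_min fz orbT /= le_max (ltW f00).
rewrite in_itv /= => /andP[u0 u1] /eqP; apply/negP; apply: f0.
case/andP: z1 => z10 z11; case/andP: z2 => z20 z21.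
split; rewrite /= ?mulr_ge0 //=.
  by apply: le_trans z11; rewrite ler_piMl.
by apply: le_trans z21; rewrite ler_piMl.
Qed.

(** Let w = (cos z.1, e^(2 i z.2) sin z.1), the unit eigenvector of x.sigma for the eigenvalue 1.
    Then g + i h below is <w, v>, and the form equals 2 |<w, v>|^2 - |v|^2, so its positivity keeps
    g + i h away from 0. At one pole w is constant; at the other it is (0, e^(2 i z.2)), which makes
    the loop wind once. *)
Lemma no_tautological_section_pos a b c d :
  continuous a -> continuous b -> continuous c -> continuous d ->
  (forall z w, same_point z w ->
     [/\ a z = a w, b z = b w, c z = c w & d z = d w]) ->
  (forall z, in_rect z -> 0 < pauli_form a b c d z) -> False.
Proof.
move=> ca cb cc cd inv pos.
pose C z : R := cos z.2 ^+ 2 - sin z.2 ^+ 2.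
pose D z : R := 2 * sin z.2 * cos z.2.
pose g z := cos z.1 * a z + sin z.1 * (C z * c z + D z * d z).
pose h z := cos z.1 * b z + sin z.1 * (C z * d z - D z * c z).
have kc (f : R * R -> R) : continuous f -> continuous (fun z => cos (f z)).
  by move=> cf; apply: (@ctsC _ _ _ f cos) => //; exact: continuous_cos.
have ks (f : R * R -> R) : continuous f -> continuous (fun z => sin (f z)).
  by move=> cf; apply: (@ctsC _ _ _ f sin) => //; exact: continuous_sin.
have c1 : continuous (fun z : R * R => z.1) by cts.
have c2 : continuous (fun z : R * R => z.2) by cts.
have inv0 s : same_point (0, s) (0, 0).
  by split; rewrite /sphx /sphy /sphz /= sin0; ring.
have invpi s : same_point (pi / 2, s) (pi / 2, 0).
  by split; rewrite /sphx /sphy /sphz /= sin_pihalf cos_pihalf; ring.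
have invper t : same_point (t, 0) (t, pi).
  by split; rewrite /sphx /sphy /sphz /= ?cospi ?sinpi ?cos0 ?sin0; ring.
apply: (@no_winding_homotopy R (pi / 2) g h).
- by rewrite divr_ge0 ?pi_ge0.
- by rewrite /g /C /D; cts; first [exact: kc|exact: ks].
- by rewrite /h /C /D; cts; first [exact: kc|exact: ks].
- move=> t s t0 s0; have := pos (t, s) (conj t0 s0).
  have e1 := cos2Dsin2 t; have e2 := cos2Dsin2 s.
  set G := _ ^+ 2 + _ ^+ 2.
  have -> : pauli_form a b c d (t, s) = 2 * G -
      (a (t, s) ^+ 2 + b (t, s) ^+ 2 + c (t, s) ^+ 2 + d (t, s) ^+ 2).
    have E : C (t, s) ^+ 2 + D (t, s) ^+ 2 = 1.
      transitivity ((cos s ^+ 2 + sin s ^+ 2) ^+ 2); last by rewrite e2 expr1n.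
      by rewrite /C /D /=; ring.
    rewrite /G /g /h /pauli_form /sphx /sphy /sphz /= -/(C (t, s)) -/(D (t, s)).
    set C' := C _ in E *; set D' := D _ in E *.
    transitivity (2 * G - (cos t ^+ 2 + sin t ^+ 2) * (a (t, s) ^+ 2 + b (t, s) ^+ 2)
      - (2 * sin t ^+ 2 * (C' ^+ 2 + D' ^+ 2) + cos t ^+ 2 - sin t ^+ 2) *
        (c (t, s) ^+ 2 + d (t, s) ^+ 2)).
      by rewrite /C' /D' /C /D /G /g /h /C /D /=; ring.
    have -> : 2 * sin t ^+ 2 * (C' ^+ 2 + D' ^+ 2) + cos t ^+ 2 - sin t ^+ 2 = 1.
      by rewrite E -[RHS]e1; ring.
    by rewrite e1 /G /g /h /C' /D' /=; ring.
  have := sqr_ge0 (a (t, s)); have := sqr_ge0 (b (t, s)).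
  have := sqr_ge0 (c (t, s)); have := sqr_ge0 (d (t, s)).
  by move=> *; lra.
- move=> t; rewrite /g /h /C /D /= cospi sinpi cos0 sin0.
  by have [-> -> -> ->] := inv _ _ (invper t); split; ring.
- move=> s; rewrite /g /h /= cos0 sin0.
  by have [-> -> _ _] := inv _ _ (inv0 s); split; ring.
- exists (c (pi / 2, 0)), (d (pi / 2, 0)) => s.
  rewrite /g /h /C /D /= cos_pihalf sin_pihalf.
  by have [_ _ -> ->] := inv _ _ (invpi s); split; ring.
Qed.

Lemma no_tautological_section a b c d :
  continuous a -> continuous b -> continuous c -> continuous d ->
  (forall z w, same_point z w ->
     [/\ a z = a w, b z = b w, c z = c w & d z = d w]) ->
  (forall z, in_rect z -> pauli_form a b c d z != 0) -> False.
Proof.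
move=> ca cb cc cd inv nz.
have cP : continuous (pauli_form a b c d).
  by have [x y z] := cts_sph; rewrite /pauli_form; cts.
have [pos|npos] := ltP 0 (pauli_form a b c d (0, 0)).
  apply: (no_tautological_section_pos ca cb cc cd inv).
  exact: (rect_sign cP nz pos).
have r0 : in_rect (0, 0) by rewrite /in_rect /= !lexx !divr_ge0 ?pi_ge0.
have neg : 0 < - pauli_form a b c d (0, 0).
  by rewrite oppr_gt0 lt_neqAle nz.
have pos' : forall z, in_rect z -> 0 < - pauli_form a b c d z.
  apply: rect_sign => //; first by cts.
  by move=> z /nz; rewrite oppr_eq0.
(* The quaternionic structure (v0, v1) |-> (conj v1, - conj v0) reverses the
   sign of the form. *)
apply: (@no_tautological_section_pos c (fun z => - d z) (fun z => - a z) b).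
- by cts.
- by cts.
- by cts.
- by cts.
- by move=> z w /inv [-> -> -> ->].
- move=> z /pos'; congr (_ < _); rewrite /pauli_form; ring.
Qed.

End Hedgehog.

(* [1 + q2 - q1] maps a fixed vector of [q1] to its image under [q2] and is
   invertible when [q1] and [q2] are close: fixed vectors of [q (t, _)] can be
   transported to neighbouring values of [t], uniformly on a compact set. *)
Lemma idempotent_section (R : realType) (K : numFieldType) (T : topologicalType)
    (A : set T) (n : nat) (a b : R) (k0 : T) (q : R * T -> 'M[K]_n) :
  compact A -> a <= b ->
  (forall i j, continuous (fun z => q z i j)) ->
  (forall z, q z *m q z = q z) ->
  (forall k, q (a, k) = q (a, k0)) -> q (a, k0) != 0 ->
  exists v : T -> 'cV[K]_n,
    [/\ forall i, continuous (fun k => v k i 0),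
        forall k, A k -> v k != 0,
        forall k, q (b, k) *m v k = v k &
        forall k k', (forall t, q (t, k) = q (t, k')) -> v k = v k'].
Proof.
move=> cA ab cq qq q0 qn0.
(* The last clause is carried along so that, when points of [T] are polar coordinates, [v] is well
   defined on the sphere. *)
pose P t := exists v : T -> 'cV[K]_n,
    [/\ forall i, continuous (fun k => v k i 0),
        forall k, A k -> v k != 0,
        forall k, q (t, k) *m v k = v k &
        forall k k', (forall t, q (t, k) = q (t, k')) -> v k = v k'].
apply: (segment_near_diagonal (P := P) ab).
  (* At t = a the idempotent is constant in k, so one of its nonzero columns is a constant
     section. *)
  have [j qj] : exists j, col j (q (a, k0)) != 0.
    apply/not_existsP => H; move/eqP: qn0; apply; apply/matrixP => i j.
    by move/negP: (H j); rewrite negbK => /eqP/colP/(_ i); rewrite !mxE.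
  exists (fun=> col j (q (a, k0))); split=> //.
  - by move=> i; exact: cts_cst.
  - by move=> k; rewrite q0 colE mulmxA qq.
move=> t tab.
pose M (w : T * (R * R)) := 1%:M + q (w.2.2, w.1) - q (w.2.1, w.1).
have cM i j : continuous (fun w => M w i j).
  under [X in continuous X]eq_fun do rewrite !mxE.
  have cqk (f : T * (R * R) -> R * T) : continuous f ->
      continuous (fun w => q (f w) i j).
    by move=> cf; apply: (@ctsC _ _ _ f (fun z => q z i j)).
  apply: ctsD; first by apply: ctsD; [exact: cts_cst|apply: cqk; cts].
  by apply: ctsN; apply: cqk; cts.
have nearM : \forall z \near (t, t), A `<=` [set k | \det (M (k, z)) != 0].
  move: cA; rewrite compact_near_coveringP.
  move=> /(_ _ (nbhs ((t, t) : R * R)) (fun z k => \det (M (k, z)) != 0)).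
  apply=> k Ak.
  have M1 : \det (M (k, (t, t))) != 0 by rewrite /M /= addrK det1 oner_neq0.
  have cd : continuous (fun w => \det (M w)) by exact: cts_det.
  exact: (cvgr_neq0 (\det (M (k, (t, t)))) (cd (k, (t, t))) M1).
near=> z => -[v [cv vn0 qv vi]].
have nM : A `<=` [set k | \det (M (k, z)) != 0] by near: z.
exists (fun k => q (z.2, k) *m v k); split.
- move=> i; apply: cts_mulmx => [{}i j|{}i j]; last by rewrite ord1.
  by apply: (@ctsC _ _ _ (fun k : T => (z.2, k)) (fun z => q z i j)) => //; cts.
- move=> k Ak; apply/negP => /eqP qv0.
  have Mu : M (k, z) \in unitmx by rewrite unitmxE unitfE; exact: nM.
  have : M (k, z) *m v k = 0.
    by rewrite /M /= mulmxBl mulmxDl mul1mx qv qv0 addr0 subrr.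
  move=> /(congr1 (mulmx (invmx (M (k, z))))); rewrite mulKmx// mulmx0.
  by apply/eqP; exact: vn0.
- by move=> k; rewrite mulmxA qq.
- by move=> k k' H; rewrite H (vi _ _ H).
Unshelve. all: by end_near.
Qed.

(** * The homomorphism *)

Section Reflection.
Context {C : numClosedFieldType} (N : 'M[C]_2).
Implicit Types a b c d : C.

(* The functional calculus of an involution [N]: the eigenvalue [1] is sent to
   [a] and [-1] to [b]. *)
Definition involution_fun a b : 'M[C]_2 :=
  ((a + b) / 2)%:M + ((a - b) / 2) *: N.

Lemma involution_fun_cst a : involution_fun a a = a%:M.
Proof.
rewrite /involution_fun subrr mul0r scale0r addr0.
by congr (_%:M); field.
Qed.

Lemma involution_funD a b c d :
  involution_fun (a + c) (b + d) = involution_fun a b + involution_fun c d.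
Proof.
apply/matrixP => i j; rewrite !mxE.
by case: (i == j); rewrite ?mulr1n ?mulr0n; field.
Qed.

Lemma involution_funZ c a b :
  involution_fun (c * a) (c * b) = c *: involution_fun a b.
Proof.
apply/matrixP => i j; rewrite !mxE.
by case: (i == j); rewrite ?mulr1n ?mulr0n; field.
Qed.

Lemma involution_funM a b c d : N *m N = 1%:M ->
  involution_fun (a * c) (b * d) = involution_fun a b *m involution_fun c d.
Proof.
move=> N2; rewrite /involution_fun mulmxDl !mulmxDr -scalar_mxM mul_scalar_mx.
rewrite mul_mx_scalar -!scalemxAl -!scalemxAr N2.
apply/matrixP => i j; rewrite !mxE.
by case: (i == j); rewrite ?mulr1n ?mulr0n; field.
Qed.

Lemma involution_fun_adj a b : N^t* = N ->
  involution_fun a^* b^* = (involution_fun a b)^t*.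
Proof.
move=> NA; apply/matrixP => i j; rewrite !mxE.
have -> : N i j = (N j i)^* by rewrite -[in LHS]NA !mxE.
rewrite rmorphD rmorphM rmorphMn /= !fmorph_div /= rmorphD rmorphB /= eq_sym.
by rewrite conjC_nat.
Qed.

End Reflection.

Section PauliHomomorphism.
Context {R : realType}.
Local Notation S3 := (set_type (sphere3 R)).
Local Notation S1 := (set_type (circle R)).
Local Notation C := (Cplx R).
Local Open Scope complex_scope.

Definition crd (i : 'I_4) (y : S3) : R := (set_val y : 'rV[R]_4) 0 i.

Lemma cts_crd i : continuous (crd i).
Proof.
apply: (@ctsC _ _ _ (set_val : S3 -> 'rV[R]_4) (fun v : 'rV[R]_4 => v 0 i)).
  exact: cts_set_val.
exact: coord_continuous.
Qed.

Local Notation i0 := (@Ordinal 4 0 isT).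
Local Notation i1 := (@Ordinal 4 1 isT).
Local Notation i2 := (@Ordinal 4 2 isT).
Local Notation i3 := (@Ordinal 4 3 isT).

Lemma crd_norm y :
  crd i0 y ^+ 2 + crd i1 y ^+ 2 + crd i2 y ^+ 2 + crd i3 y ^+ 2 = 1.
Proof.
case: y => y yS; have := set_mem yS; rewrite /sphere3 /= => E; rewrite -[RHS]E.
rewrite !big_ord_recl big_ord0 /crd /= addr0 !addrA.
by congr (_ ^+ 2 + _ ^+ 2 + _ ^+ 2 + _ ^+ 2); congr (y 0 _); apply: val_inj.
Qed.

Definition vec_radius (y : S3) : R := Num.sqrt (1 - crd i0 y ^+ 2).

Lemma vec_radiusE y :
  vec_radius y ^+ 2 = crd i1 y ^+ 2 + crd i2 y ^+ 2 + crd i3 y ^+ 2.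
Proof.
have E : 1 - crd i0 y ^+ 2 = crd i1 y ^+ 2 + crd i2 y ^+ 2 + crd i3 y ^+ 2.
  by rewrite -(crd_norm y); ring.
by rewrite /vec_radius E sqr_sqrtr// !addr_ge0 ?sqr_ge0.
Qed.

Lemma cts_vec_radius : continuous vec_radius.
Proof.
apply: (@ctsC _ _ _ (fun y => 1 - crd i0 y ^+ 2) Num.sqrt).
  by cts; exact: cts_crd.
exact: sqrt_continuous.
Qed.

Lemma eigen_subproof (s : R) (y : S3) : s ^+ 2 = 1 ->
  (crd i0 y +i* (s * vec_radius y) : C) \in circle R.
Proof.
move=> s1; apply/mem_set; rewrite /circle /= normc_def /=.
rewrite exprMn s1 mul1r vec_radiusE !addrA crd_norm sqrtr1 //.
Qed.

Definition eigen (s : R) (s1 : s ^+ 2 = 1) (y : S3) : S1 :=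
  exist (fun z => z \in circle R) (crd i0 y +i* (s * vec_radius y))
    (eigen_subproof y s1).

Lemma cts_eigen s (s1 : s ^+ 2 = 1) : continuous (eigen s1).
Proof.
apply: cts_set_type; apply: cts_complex; first exact: cts_crd.
by cts; exact: cts_vec_radius.
Qed.

Definition eigenp : S3 -> S1 := eigen (expr1n R 2).
Definition eigenm : S3 -> S1 := eigen (s := -1) (sqrr_sign R 1).

Lemma eigen_pole y : vec_radius y = 0 -> eigenp y = eigenm y.
Proof. by move=> r0; apply: val_inj; rewrite /= r0 !mulr0. Qed.

Definition pauli (x y z : R) : 'M[C]_2 := \matrix_(i, j)
  (if i == j then (if i == 0 then z%:C else - z%:C)
   else if i == 0 then x%:C - 'i%C * y%:C else x%:C + 'i%C * y%:C).

Lemma pauli_sqr x y z :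
  pauli x y z *m pauli x y z = ((x ^+ 2 + y ^+ 2 + z ^+ 2)%:C)%:M.
Proof.
apply/matrixP => i j; rewrite !mxE !big_ord_recl big_ord0 !mxE /= addr0.
have I2 : ('i%C : C) ^+ 2 = -1 by exact: sqr_i.
have e : (x ^+ 2 + y ^+ 2 + z ^+ 2)%:C = x%:C ^+ 2 - 'i%C ^+ 2 * y%:C ^+ 2 + z%:C ^+ 2 :> C.
  by rewrite I2 !rmorphD !rmorphXn /=; ring.
case: i => [[|[|//]] ?]; case: j => [[|[|//]] ?]; rewrite /= ?mulr1n ?mulr0n ?e; ring.
Qed.

Lemma pauli_adj x y z : (pauli x y z)^t* = pauli x y z.
Proof.
apply/matrixP => i j; rewrite !mxE.
have conjE (w : C) : (w^*)%R = conjc w by [].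
rewrite conjE.
case: i => [[|[|//]] ?]; case: j => [[|[|//]] ?] /=; apply/eqP;
  by rewrite eq_complex /=; apply/andP; split; apply/eqP; ring.
Qed.

(** At the poles y0 = 1 and y0 = -1 this is a division by zero, with value 0; there the two
    eigenvalues coincide and the coefficient of [pauli_dir] in the functional calculus vanishes. *)
Definition unit_vec (j : 'I_4) (y : S3) : R := crd j y / vec_radius y.

Definition pauli_dir (y : S3) : 'M[C]_2 :=
  pauli (unit_vec i1 y) (unit_vec i2 y) (unit_vec i3 y).

Lemma pauli_dir_sqr y : vec_radius y != 0 -> pauli_dir y *m pauli_dir y = 1%:M.
Proof.
move=> r0; rewrite pauli_sqr /unit_vec !expr_div_n -!mulrDl -vec_radiusE divff//.
by rewrite expf_neq0.
Qed.

Definition pauli_calculus_mx (f : continuousType S1 C) (y : S3) : 'M[C]_2 :=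
  involution_fun (pauli_dir y) (f (eigenp y)) (f (eigenm y)).

Lemma crd_le_radius (j : 'I_4) y : j != i0 -> `|crd j y| <= vec_radius y.
Proof.
move=> j0; rewrite -sqrtr_sqr ler_wsqrtr//.
have -> : 1 - crd i0 y ^+ 2 = crd i1 y ^+ 2 + crd i2 y ^+ 2 + crd i3 y ^+ 2.
  by rewrite -(crd_norm y); ring.
have := (sqr_ge0 (crd i1 y), sqr_ge0 (crd i2 y), sqr_ge0 (crd i3 y)).
case=> -[] + + +.
case: j j0 => [[|[|[|[|//]]]] p] //= _; set k := Ordinal p.
- by rewrite (_ : k = i1) => [*|]; [lra|exact: val_inj].
- by rewrite (_ : k = i2) => [*|]; [lra|exact: val_inj].
- by rewrite (_ : k = i3) => [*|]; [lra|exact: val_inj].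
Qed.

Lemma cts_eigen_eval (f : continuousType S1 C) s (s1 : s ^+ 2 = 1) :
  continuous (fun y => f (eigen s1 y) : C).
Proof.
apply: (@ctsC S3 S1 C (eigen s1) f); first exact: cts_eigen.
exact: cts_fun.
Qed.

(** The direction x / |x| has no limit at the poles, but its coordinates are bounded by 1, and the
    difference of the values of f at the two eigenvalues tends to 0 there. *)
Lemma cts_pauli_calculus_coord (f : continuousType S1 C) (j : 'I_4) : j != i0 ->
  continuous (fun y => (f (eigenp y) - f (eigenm y)) / 2 * (unit_vec j y)%:C).
Proof.
move=> j0; apply: cts_mul_bounded.
- apply: ctsM; last exact: cts_cst.
  by apply: ctsD; [|apply: ctsN]; exact: cts_eigen_eval.
- move=> y; rewrite normc_def /= expr0n addr0 sqrtr_sqr /unit_vec.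
  rewrite (_ : 1 = 1%:C)// lecR normrM normfV.
  have [->|r0] := eqVneq (vec_radius y) 0; first by rewrite normr0 invr0 mulr0.
  rewrite (ger0_norm (sqrtr_ge0 _)) ler_pdivrMr ?mul1r ?crd_le_radius//.
  by rewrite lt_neqAle eq_sym r0 sqrtr_ge0.
- move=> y w0.
  have r0 : vec_radius y != 0.
    by apply: contraNneq w0 => /eigen_pole ->; rewrite subrr mul0r.
  have cu : {for y, continuous (unit_vec j)}.
    exact: (cvgM (@cts_crd j y) (cvgV r0 (@cts_vec_radius y))).
  apply: (continuous_comp cu).
  exact: (@cts_real_complex R R id (@cts_id R)).
Qed.

Lemma cts_pauli_calculus (f : continuousType S1 C) :
  continuous (pauli_calculus_mx f).
Proof.
have c1 := @cts_pauli_calculus_coord f i1 isT.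
have c2 := @cts_pauli_calculus_coord f i2 isT.
have c3 := @cts_pauli_calculus_coord f i3 isT.
have cu : continuous (fun y => (f (eigenp y) + f (eigenm y)) / 2).
  apply: ctsM; last exact: cts_cst.
  by apply: ctsD; exact: cts_eigen_eval.
apply: cts_mx => i j.
under [X in continuous X]eq_fun do rewrite !mxE.
apply: ctsD.
  by case: (i == j); [exact: cu|exact: cts_cst].
case: (i == j); case: (i == 0).
- exact: c3.
- under [X in continuous X]eq_fun do rewrite mulrN.
  by apply: ctsN; exact: c3.
- under [X in continuous X]eq_fun do rewrite mulrBr mulrCA.
  apply: ctsD; first exact: c1.
  by apply: ctsN; apply: ctsM; [exact: cts_cst|exact: c2].
- under [X in continuous X]eq_fun do rewrite mulrDr mulrCA.
  apply: ctsD; first exact: c1.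
  by apply: ctsM; [exact: cts_cst|exact: c2].
Qed.

Definition pauli_calculus (f : continuousType S1 C) :
  continuousType S3 'M[C]_2 :=
  mkcts (@cts_pauli_calculus f).

Lemma pauli_calculus_hom : unital_star_hom pauli_calculus.
Proof.
split=> [y|f g y|c f y|f g y|f y].
- exact: involution_fun_cst.
- exact: involution_funD.
- exact: involution_funZ.
- have [r0|r0] := eqVneq (vec_radius y) 0; last first.
    exact: (involution_funM _ _ _ _ (pauli_dir_sqr r0)).
  (* At a pole [pauli_dir y] is 0 and not an involution, but the eigenvalues agree, so all matrices
     involved are scalar. *)
  change (involution_fun (pauli_dir y) (f (eigenp y) * g (eigenp y))
            (f (eigenm y) * g (eigenm y)) =
          involution_fun (pauli_dir y) (f (eigenp y)) (f (eigenm y)) *m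
          involution_fun (pauli_dir y) (g (eigenp y)) (g (eigenm y))).
  rewrite (eigen_pole r0) !involution_fun_cst.
  by rewrite -scalar_mxM.
- exact: (involution_fun_adj _ _ (pauli_adj _ _ _)).
Qed.

End PauliHomomorphism.

(** * Euclidean norm and pointwise consequences of the supremum norm *)

Section L2.
Context {R : realType}.
Local Notation C := (Cplx R).

Lemma l2norm_ge0 n (v : 'cV[C]_n) : 0 <= l2norm v.
Proof. exact: sqrtr_ge0. Qed.

Lemma l2norm_sqr n (v : 'cV[C]_n) :
  l2norm v ^+ 2 =
    \sum_(i < n) (complex.Re (v i 0) ^+ 2 + complex.Im (v i 0) ^+ 2).
Proof.
rewrite sqr_sqrtr; last by apply: sumr_ge0 => i _; exact: sqr_ge0.
apply: eq_bigr => i _; case: (v i 0) => a b /=.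
by rewrite sqr_sqrtr// addr_ge0 ?sqr_ge0.
Qed.

Lemma l2norm_scale n (c : R) (v : 'cV[C]_n) :
  0 <= c -> l2norm ((c%:C)%C *: v) = c * l2norm v.
Proof.
move=> c0; apply: (@pexpIrn _ 2) => //; rewrite ?nnegrE ?mulr_ge0 ?l2norm_ge0//.
rewrite exprMn !l2norm_sqr mulr_sumr; apply: eq_bigr => i _.
by rewrite !mxE; case: (v i 0) => a b /=; ring.
Qed.

Lemma l2norm_eq0 n (v : 'cV[C]_n) : l2norm v = 0 -> v = 0.
Proof.
move=> v0; have : l2norm v ^+ 2 = 0 by rewrite v0 expr0n.
rewrite l2norm_sqr => /eqP; rewrite psumr_eq0; last first.
  by move=> i _; rewrite addr_ge0 ?sqr_ge0.
move=> /allP H; apply/matrixP => i j; rewrite ord1 mxE.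
have := H i (mem_index_enum i); case: (v i 0) => a b /=.
by rewrite paddr_eq0 ?sqr_ge0// !sqrf_eq0 => /andP[/eqP -> /eqP ->].
Qed.

(** After normalization of v this is the definition of the norms. It is the form in which the
    approximation is used: at one point and on one vector. *)
Lemma supnorm_lt1 (Y : Type) n (g : Y -> 'M[C]_n) y (v : 'cV[C]_n) :
  (supnorm g < 1%:E)%E -> l2norm (g y *m v) <= l2norm v.
Proof.
move=> g1; have [v0|v0] := eqVneq (l2norm v) 0.
  by rewrite (l2norm_eq0 v0) mulmx0.
have vp : 0 < l2norm v by rewrite lt_neqAle eq_sym v0 l2norm_ge0.
pose c := (l2norm v)^-1; have cp : 0 < c by rewrite invr_gt0.
have : ((l2norm (g y *m ((c%:C)%C *: v)))%:E < 1%:E)%E.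
  apply: le_lt_trans g1; apply: (@le_trans _ _ (opnorm (g y))).
    apply: ereal_sup_ubound; exists ((c%:C)%C *: v) => //=.
    by rewrite l2norm_scale ?(ltW cp)// /c mulVf.
  by apply: ereal_sup_ubound; exists y.
rewrite lte_fin -scalemxAr l2norm_scale ?(ltW cp)// mulrC ltr_pdivrMr// mul1r.
exact: ltW.
Qed.

End L2.

(** * Transport over the hemisphere and the contradiction on the equator *)

Section Main.
Context {R : realType}.
Local Notation S3 := (set_type (sphere3 R)).
Local Notation S1 := (set_type (circle R)).
Local Notation C := (Cplx R).

(** Spherical coordinates: z.1 is the angle from the pole y0 = 1 and z.2 gives the direction of x.
    The values 0 <= z.1 <= pi / 2 sweep the hemisphere y0 >= 0, ending on the equatorial
    2-sphere. *)
Definition ray_row (z : R * (R * R)) : 'rV[R]_4 := \row_(j < 4)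
  if j == 0 :> nat then cos z.1 else
  sin z.1 * (if j == 1 :> nat then sphx z.2
             else if j == 2 :> nat then sphy z.2 else sphz z.2).

Lemma ray_subproof z : ray_row z \in sphere3 R.
Proof.
apply/mem_set; rewrite /sphere3 /= !big_ord_recl big_ord0 !mxE /= addr0.
transitivity (cos z.1 ^+ 2 + sin z.1 ^+ 2 *
    (sphx z.2 ^+ 2 + sphy z.2 ^+ 2 + sphz z.2 ^+ 2)); first by ring.
by rewrite sph_norm mulr1 cos2Dsin2.
Qed.

Definition ray (z : R * (R * R)) : S3 :=
  exist (fun u => u \in sphere3 R) (ray_row z) (ray_subproof z).

Lemma cts_ray : continuous ray.
Proof.
have [cx cy cz] := @cts_sph R.
have c2 (f : R * R -> R) : continuous f -> continuous (fun z : R * (R * R) => f z.2).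
  by move=> cf; apply: (@ctsC _ _ _ (fun z : R * (R * R) => z.2) f) => //; cts.
have ccos : continuous (fun z : R * (R * R) => cos z.1).
  by apply: (@ctsC _ _ _ (fun z : R * (R * R) => z.1) cos); [cts|exact: continuous_cos].
have csin : continuous (fun z : R * (R * R) => sin z.1).
  by apply: (@ctsC _ _ _ (fun z : R * (R * R) => z.1) sin); [cts|exact: continuous_sin].
apply: cts_set_type; apply: cts_mx => i j.
under [X in continuous X]eq_fun do rewrite mxE.
case: j => [[|[|[|[|//]]]] ?] /=; first exact: ccos.
- by apply: ctsM => //; exact: c2.
- by apply: ctsM => //; exact: c2.
- by apply: ctsM => //; exact: c2.
Qed.

Lemma ray_same z w t : same_point z w -> ray (t, z) = ray (t, w).
Proof.
case=> ex ey ez; apply: val_inj; apply/matrixP => i j.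
by rewrite /= !mxE /= ex ey ez.
Qed.

Lemma ray0 z w : ray (0, z) = ray (0, w).
Proof.
apply: val_inj; apply/matrixP => i j.
by rewrite /= !mxE /= sin0 !mul0r.
Qed.

Lemma radius_equator z : vec_radius (ray (pi / 2, z)) = 1.
Proof.
by rewrite /vec_radius /crd /= set_valE /= mxE /= cos_pihalf expr0n /= subr0 sqrtr1.
Qed.

(** The only test function of the argument; its image under [pauli_calculus] is the unitary y0 + i
    x.sigma. *)
Definition incl : continuousType S1 C := mkcts (@cts_set_val C (circle R)).

Lemma pauli_calculus_equator z : pauli_calculus incl (ray (pi / 2, z)) =
  ('i%C : C) *: pauli (sphx z) (sphy z) (sphz z).
Proof.
set y := ray _.
have r1 : vec_radius y = 1 by exact: radius_equator.
have y0 : crd (@Ordinal 4 0 isT) y = 0.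
  by rewrite /crd /= set_valE /= mxE /= cos_pihalf.
have ep : incl (eigenp y) = 'i%C :> C.
  transitivity ((crd (@Ordinal 4 0 isT) y +i* (1 * vec_radius y))%C : C); first by [].
  by rewrite r1 y0 mulr1.
have em : incl (eigenm y) = - 'i%C :> C.
  transitivity ((crd (@Ordinal 4 0 isT) y +i* (-1 * vec_radius y))%C : C); first by [].
  by rewrite r1 y0 mulr1 -[RHS]/((- 0) +i* (- 1))%C oppr0.
have dirE : pauli_dir y = pauli (sphx z) (sphy z) (sphz z).
  by rewrite /pauli_dir /unit_vec r1 !divr1 /crd /= !set_valE /= !mxE /=
    sin_pihalf !mul1r.
change (involution_fun (pauli_dir y) (incl (eigenp y)) (incl (eigenm y)) =
  ('i%C : C) *: pauli (sphx z) (sphy z) (sphz z)).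
rewrite ep em dirE /involution_fun subrr mul0r opprK.
rewrite (_ : 0%:M = 0) ?add0r; last exact: raddf0.
by congr (_ *: _); field.
Qed.

(** With S = x.sigma, which preserves norms as |x| = 1, one has |i S v - al v|^2 = 2 |v|^2 - 2
    Im(al) <v, S v>. If the form <v, S v> vanished, the left side would be 2 |v|^2, contrary to the
    bound |v|^2. *)
Lemma pauli_form_neq0 (al : C) z (v : 'cV[C]_2) : `|al| = 1 -> v != 0 ->
  l2norm (('i%C : C) *: (pauli (sphx z) (sphy z) (sphz z) *m v) - al *: v)
    <= l2norm v ->
  pauli_form (fun=> complex.Re (v 0 0)) (fun=> complex.Im (v 0 0))
    (fun=> complex.Re (v 1 0)) (fun=> complex.Im (v 1 0)) z != 0.
Proof.
move=> al1 v0 H; apply/eqP => F0.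
have vp : 0 < l2norm v ^+ 2.
  rewrite lt_neqAle sqr_ge0 andbT eq_sym sqrf_eq0.
  by apply: contraNneq v0 => /l2norm_eq0 ->.
have := H; rewrite -(@ler_pXn2r _ 2)// ?nnegrE ?l2norm_ge0// leNgt.
apply/negP; rewrite negbK; move: vp.
have al2 : complex.Re al ^+ 2 + complex.Im al ^+ 2 = 1.
  by apply: complexI; rewrite add_Re2_Im2 al1 expr1n.
set N := l2norm v ^+ 2.
suff -> : l2norm ('i%C *: (pauli (sphx z) (sphy z) (sphz z) *m v) - al *: v) ^+ 2
    = 2 * N by move=> ?; lra.
transitivity ((sphx z ^+ 2 + sphy z ^+ 2 + sphz z ^+ 2) * N +
    (complex.Re al ^+ 2 + complex.Im al ^+ 2) * N -
    2 * complex.Im al * pauli_form (fun=> complex.Re (v 0 0)) (fun=> complex.Im (v 0 0))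
    (fun=> complex.Re (v 1 0)) (fun=> complex.Im (v 1 0)) z); last first.
  by rewrite F0 sph_norm al2; ring.
rewrite /N !l2norm_sqr !big_ord_recl !big_ord0 !mxE !big_ord_recl !big_ord0 !mxE /=.
rewrite (_ : lift ord0 ord0 = 1 :> 'I_2); last exact: val_inj.
rewrite (_ : ord0 = 0 :> 'I_2); last exact: val_inj.
rewrite /pauli_form; case: al {al1 al2 H F0} => x y.
case: (v 0 0) => a b; case: (v 1 0) => c d /=.
ring.
Qed.

Lemma compact_rect : compact [set z : R * R | in_rect z].
Proof.
rewrite (_ : [set z | _] = `[0, pi / 2]%classic `*` `[0, pi]%classic).
  by apply: compact_setX; exact: segment_compact.
by apply/seteqP; split => -[a b] /=; rewrite /in_rect /= !in_itv.
Qed.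

Lemma spectral_sum_mulmx (K : fieldType) (A : 'M[K]_2) (x : 'I_2 -> K)
    (P : 'I_2 -> 'M[K]_2) (u : 'cV[K]_2) :
  P 0 *m u = u -> P 1 *m P 0 = 0 ->
  (A - \sum_(i < 2) x i *: P i) *m u = A *m u - x 0 *: u.
Proof.
move=> P0u P10; have P1u : P 1 *m u = 0 by rewrite -P0u mulmxA P10 mul0mx.
rewrite !big_ord_recl big_ord0 addr0.
rewrite (_ : lift ord0 ord0 = 1 :> 'I_2); last exact: val_inj.
rewrite (_ : ord0 = 0 :> 'I_2); last exact: val_inj.
by rewrite mulmxBl mulmxDl -!scalemxAl P0u P1u scaler0 addr0.
Qed.

Lemma pauli_calculus_not_diagonalizable :
  ~ approximately_diagonalizable (@pauli_calculus R).
Proof.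
move=> /(_ 1 [set incl] ltr01 (finite_set1 _)) [al [p [p1 p0 /(_ _ erefl) close]]].
(* The range of [p 0] is transported along the rays from the pole, where all rays meet, to the
   equator. *)
have [v [cv vn0 qv vi]] : exists v : R * R -> 'cV[C]_2,
    [/\ forall i, continuous (fun k => v k i 0),
        forall k, in_rect k -> v k != 0,
        forall k, p 0 (ray (pi / 2, k)) *m v k = v k &
        forall k k', (forall t, p 0 (ray (t, k)) = p 0 (ray (t, k'))) -> v k = v k'].
  apply: (@idempotent_section R C (R * R)%type [set z | in_rect z] 2 0 (pi / 2)
     (0, 0) (fun z => p 0 (ray z))).
  - exact: compact_rect.
  - by rewrite divr_ge0 ?pi_ge0.
  - move=> i j; apply: (@ctsC _ _ _ (fun z => p 0 (ray z)) (fun A : 'M[C]_2 => A i j)).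
      apply: (@ctsC _ _ _ ray (p 0)); first exact: cts_ray.
      exact: cts_fun.
    exact: coord_continuous.
  - by move=> z; have [] := p1 0 (ray z).
  - by move=> k; rewrite (ray0 k (0, 0)).
  - apply/eqP => q0; have [_ _] := p1 0 (ray (0, (0, 0))).
    by rewrite q0 mxrank0.
apply: (@no_tautological_section R
   (fun k => complex.Re (v k 0 0)) (fun k => complex.Im (v k 0 0))
   (fun k => complex.Re (v k 1 0)) (fun k => complex.Im (v k 1 0))).
- exact: (cts_Re (cv 0)).
- exact: (cts_Im (cv 0)).
- exact: (cts_Re (cv 1)).
- exact: (cts_Im (cv 1)).
- by move=> z w zw; rewrite (vi z w)// => t; rewrite (ray_same t zw).
- move=> k kr; set y := ray (pi / 2, k).
  have al1 : `|set_val (al 0 y)| = 1 by exact: (set_mem (valP (al 0 y))).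
  apply: (pauli_form_neq0 al1 (vn0 k kr)).
  have := supnorm_lt1 y (v k) close.
  (* On the range of [p 0] the other projection vanishes, so the approximating sum acts on [v k] as
     the scalar [al 0 y] of modulus 1. *)
  rewrite (spectral_sum_mulmx _ _ (qv k) (p0 1 0 isT y)).
  by rewrite [pauli_calculus incl y]pauli_calculus_equator -scalemxAl.
Qed.

End Main.

Theorem corollary7p4 (R : realType) :
  exists phi : continuousType (set_type (circle R)) (Cplx R) ->
               continuousType (set_type (sphere3 R)) 'M[Cplx R]_2,
    unital_star_hom phi /\ ~ approximately_diagonalizable phi.
Proof.
exists (@pauli_calculus R).
by split; [exact: pauli_calculus_hom|exact: pauli_calculus_not_diagonalizable].
Qed.
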